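(* Let $\lambda_1,\ldots,\lambda_n\in(0,1)$, let $p_1,\ldots,p_n\in\mathbb{R}^d$, let $f_j(x)=\lambda_j x+(1-\lambda_j)p_j$ for $1\le j\le n$, and let $\Lambda\subset\mathbb{R}^d$ be the attractor of $\{f_j\}_{j=1}^n$. Suppose $\mathcal{L}(\Lambda)>0$. Then Lebesgue almost every $x\in\Lambda$ has a universal coding.
   Context: The attractor $\Lambda$ of $\{f_j\}_{j=1}^n$ is the unique nonempty compact set $\Lambda\subset\mathbb{R}^d$ with $\Lambda=\bigcup_{j=1}^n f_j(\Lambda)$. A coding of $x\in\Lambda$ is a sequence $(\epsilon_i)_{i=1}^\infty\in\{1,\ldots,n\}^{\mathbb{N}}$ such that $\lim_{N\to\infty}f_{\epsilon_1}\cdots f_{\epsilon_N}(0)=x$, where $f_{\epsilon_1}\cdots f_{\epsilon_N}$ denotes the composition $f_{\epsilon_1}\circ\cdots\circ f_{\epsilon_N}$. A coding $(\epsilon_i)_{i=1}^\infty$ of $x$ is universal if for every finite block $\delta_1\cdots\delta_N$ of elements of $\{1,\ldots,n\}$ there exists $k\in\mathbb{N}$ such that $\epsilon_{k+i}=\delta_i$ for $1\le i\le N$. $\mathcal{L}$ denotes $d$-dimensional Lebesgue measure. *)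

(* Defs.v *)
From HB Require Import structures.
From mathcomp Require Import all_boot all_order all_algebra.
From mathcomp Require Import all_classical all_reals all_analysis.

Set Implicit Arguments.
Unset Strict Implicit.
Unset Printing Implicit Defensive.
Import Order.TTheory GRing.Theory Num.Theory.
Import numFieldNormedType.Exports.

Local Open Scope classical_set_scope.
Local Open Scope ring_scope.

Section lebesgue_measure_in_dimension_d.
Context (R : realType) (d : nat).
(* The dimension is d.+1: for a zero-dimensional space every box would have
   volume 1 and the infimum below would not vanish on the empty set. *)
Notation V := 'rV[R]_d.+1.

Definition box (B : V * V) : set V :=
  [set x | forall i, B.1 ord0 i <= x ord0 i <= B.2 ord0 i].

Definition box_volume (B : V * V) : R :=
  \prod_i (B.2 ord0 i - B.1 ord0 i).

Definition is_box (B : V * V) : Prop := forall i, B.1 ord0 i <= B.2 ord0 i.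

Definition box_cover (A : set V) : set (nat -> V * V) :=
  [set B | (forall k, is_box (B k)) /\ A `<=` \bigcup_k box (B k)].

Definition lebesgue_outer_measure (A : set V) : \bar R :=
  ereal_inf [set (\sum_(k <oo) (box_volume (B k))%:E)%E | B in box_cover A].

Local Open Scope ereal_scope.
Local Notation mu := lebesgue_outer_measure.

Lemma box_volume_ge0 B : is_box B -> 0 <= (box_volume B)%:E.
Proof.
by move=> hB; rewrite lee_fin prodr_ge0// => i _; rewrite subr_ge0.
Qed.

Lemma lebesgue_outer_measure_ge0 A : 0 <= mu A.
Proof.
apply: le_ereal_inf_tmp => _ [B [hB _] <-].
by apply: nneseries_ge0 => k _ _; exact: box_volume_ge0.
Qed.

Lemma lebesgue_outer_measure0 : mu set0 = 0.
Proof.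
apply/eqP; rewrite eq_le lebesgue_outer_measure_ge0 andbT.
apply: ereal_inf_lbound; exists (fun=> (0, 0)%R).
  by split => // k i.
by apply: eseries0 => k _ _; rewrite /box_volume (bigD1 ord0)//= subrr mul0r.
Qed.

Lemma le_lebesgue_outer_measure : {homo mu : A B / A `<=` B >-> A <= B}.
Proof.
move=> A B AB; apply/ereal_inf_le_tmp => _ [C [hC BC] <-].
by exists C => //; split => //; exact: subset_trans BC.
Qed.

Lemma lebesgue_outer_measure_sigma_subadditive : sigma_subadditive mu.
Proof.
pose vol B := (box_volume B)%:E.
move=> A; have [[i ioo]|] := pselect (exists i, mu (A i) = +oo).
  rewrite (eseries_pinfty _ _ ioo) ?leey// => n _.
  by rewrite -ltNye (lt_le_trans _ (lebesgue_outer_measure_ge0 _)).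
rewrite -forallNE => Aoo.
suff add2e (e : {posnum R}) :
    mu (\bigcup_n A n) <= \sum_(i <oo) mu (A i) + e%:num%:E.
  by apply/lee_addgt0Pr => _/posnumP[].
rewrite (le_trans _ (epsilon_trick _ _ _))//; last first.
  by move=> n; exact: lebesgue_outer_measure_ge0.
pose P n (B : nat -> V * V) := box_cover (A n) B /\
  \sum_(k <oo) vol (B k) <= mu (A n) + (e%:num / (2 ^ n.+1)%:R)%:E.
have [G PG] : {G : nat -> nat -> V * V & forall n, P n (G n)}.
  apply: (@choice _ _ P) => n; rewrite /P /lebesgue_outer_measure.
  set S := (X in ereal_inf X); move infS : (ereal_inf S) => iS.
  case: iS infS => [r Sr|Soo|Soo].
  - have en1 : (0 < e%:num / (2 ^ n.+1)%:R)%R by [].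
    have /(lb_ereal_inf_adherent en1) : ereal_inf S \is a fin_num by rewrite Sr.
    move=> [x [B [mB AnB muBx] xS]].
    by exists B; split => //; rewrite muBx -Sr; exact/ltW.
  - by have := Aoo n; rewrite /lebesgue_outer_measure Soo.
  - have := lebesgue_outer_measure_ge0 (A n).
    by rewrite /lebesgue_outer_measure Soo.
have volG_ge0 x : 0 <= (vol \o uncurry G) x.
  by case: x => n m; apply: box_volume_ge0; exact: (PG n).1.1.
apply: (@le_trans _ _ (\esum_(i in setT) (vol \o uncurry G) i)).
  apply: ereal_inf_lbound => /=.
  have /card_esym/ppcard_eqP[f] := card_nat2.
  exists (uncurry G \o f).
    split => [i|].
      by rewrite /=; case: (f i) => n m; exact: (PG n).1.1.
    move=> t [i _] /(PG i).1.2[j _ Bijt]; exists (f^-1%FUN (i, j)) => //=.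
    by rewrite invK ?inE.
  rewrite -(esum_pred_image (vol \o uncurry G) _ xpredT) ?[fun=> _]set_true//.
  by rewrite image_eq.
rewrite (_ : esum _ _ = \sum_(i <oo) \sum_(j <oo ) vol (G i j)); last first.
  pose J : nat -> set (nat * nat) := fun i => [set (i, j) | j in setT].
  rewrite (_ : setT = \bigcup_k J k); last first.
    by rewrite predeqE => -[a b]; split => // _; exists a => //; exists b.
  rewrite esum_bigcupT /=; last 2 first.
    - apply/trivIsetP => i j _ _ ij.
      rewrite predeqE => -[n m] /=; split => //= -[] [_] _ [<-{n} _].
      by move=> [m' _] [] /esym/eqP; rewrite (negbTE ij).
    - by move=> /= [n m]; exact: (volG_ge0 (n, m)).
  rewrite -(image_id [set: nat]) -fun_true esum_pred_image//; last first.
    by move=> n _; apply: esum_ge0 => x _; exact: volG_ge0.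
  apply: eq_eseriesr => /= j _.
  rewrite -(esum_pred_image (vol \o uncurry G) (pair j) predT).
  - by congr esum; rewrite predeqE => -[a b]; split; move=> [i _ <-]; exists i.
  - by move=> m _; exact: volG_ge0.
  - by move=> ? ? _ _; exact: (@can_inj _ _ _ snd).
apply: lee_lim.
- apply: is_cvg_nneseries => n *.
  by apply: nneseries_ge0 => m *; exact: (volG_ge0 (n, m)).
- apply: is_cvg_nneseries => n *; apply: adde_ge0 => //.
  exact: lebesgue_outer_measure_ge0.
- by near=> n; apply: lee_sum => i _; exact: (PG i).2.
Unshelve. all: by end_near. Qed.

HB.instance Definition _ := isOuterMeasure.Build R V mu
  lebesgue_outer_measure0 lebesgue_outer_measure_ge0 le_lebesgue_outer_measure
  lebesgue_outer_measure_sigma_subadditive.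

End lebesgue_measure_in_dimension_d.

(* The outer measure on the sigma-algebra of Caratheodory (that is, Lebesgue)
   measurable sets, where it is a complete measure. *)
Definition lebesgue_measure_rV (R : realType) (d : nat) :
    set (caratheodory_type (@lebesgue_outer_measure R d)) -> \bar R :=
  @lebesgue_outer_measure R d.

HB.instance Definition _ (R : realType) (d : nat) :=
  isMeasure.Build _ _ _ (@lebesgue_measure_rV R d)
    (@caratheodory_measure0 _ _ (@lebesgue_outer_measure R d))
    (@caratheodory_measure_ge0 _ _ (@lebesgue_outer_measure R d))
    (@caratheodory_measure_sigma_additive _ _ (@lebesgue_outer_measure R d)).

Arguments lebesgue_measure_rV : clear implicits.

Section iterated_function_systems.
Context (R : realType) (d n : nat).
Notation V := 'rV[R]_d.+1.

Definition contraction_map (lambda : 'I_n -> R) (p : 'I_n -> V) (j : 'I_n)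
  (x : V) : V := lambda j *: x + (1 - lambda j) *: p j.

Implicit Types (f : 'I_n -> V -> V) (eps : nat -> 'I_n).

Definition is_attractor f (Lambda : set V) : Prop :=
  [/\ Lambda !=set0, compact Lambda &
      Lambda = \bigcup_(j in [set: 'I_n]) (f j @` Lambda)].

(* [:: j1; ..; jN] is sent to f j1 \o .. \o f jN *)
Definition word_map f (w : seq 'I_n) : V -> V :=
  foldr (fun j g => f j \o g) idfun w.

(* Codings are indexed from 0: eps i is the (i + 1)-st digit. *)
Definition is_coding f (x : V) eps : Prop :=
  word_map f (mkseq eps N) 0 @[N --> \oo] --> x.

Definition is_universal eps : Prop :=
  forall (N : nat) (delta : N.-tuple 'I_n),
    exists k : nat, forall i : 'I_N, eps (k + i)%N = tnth delta i.

Definition has_universal_coding f (x : V) : Prop :=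
  exists eps, is_coding f x eps /\ is_universal eps.

End iterated_function_systems.

(* Main.v *)
Require Import Defs.
From mathcomp Require Import all_boot all_order all_algebra.
From mathcomp Require Import all_classical all_reals all_analysis.
From mathcomp Require Import ring lra.
Import Order.TTheory GRing.Theory Num.Theory.
Import numFieldNormedType.Exports.
Local Open Scope classical_set_scope.
Local Open Scope ring_scope.

(** For a finite word [w], let [A] be the set of points of [Lambda] that lie in
    no cylinder [f_u f_w Lambda].  Around a point of [A] near the centre of a
    roughly cubical box of side [s] there is a cylinder [f_u Lambda] of diameter
    comparable to [s], and [f_u f_w Lambda] is a homothetic copy of [Lambda] which
    misses [A] and has ratio at least [eta s], with [eta] depending only on [w].
    Hence [mu (A `&` B) <= (1 - c) vol B] for every box [B], with [c] independent
    of [B]; summing over a cover of [A] by boxes gives [mu A <= (1 - c) mu A], so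
    [A] is null.  A point outside the images, under all words, of these countably
    many null sets can be followed forever: after any prefix, every word can be
    made to appear in its coding. *)

(** * Lebesgue outer measure in dimension d+1 *)

Section lebesgue_outer_measure_theory.
Set Implicit Arguments.
Unset Strict Implicit.
Context (R : realType) (d : nat).
Notation V := 'rV[R]_d.+1.
Notation mu := (@lebesgue_outer_measure R d).
Implicit Types (x y b : V) (B : V * V) (S : set V).

Lemma rV_norm_le x (e : R) : 0 <= e -> (`|x| <= e) <-> (forall i, `|x ord0 i| <= e).
Proof.
move=> e0; rewrite [X in X <= _]/Num.norm/= mx_normrE; split => [/bigmax_leP[_ xe] i|xe].
  exact: (xe (ord0, i)).
by apply/bigmax_leP; split => // -[i j] _ /=; rewrite (ord1 i).
Qed.

Lemma lebesgue_outer_measure_box B :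
  is_box B -> (mu (box B) <= (box_volume B)%:E)%E.
Proof.
move=> hB; apply: ereal_inf_lbound; exists (fun k => if k == 0%N then B else (0, 0)).
  split => [[|k]//|x Bx].
  by exists 0%N.
rewrite nneseries_recl//; last first.
  by case=> [|k] _; apply: box_volume_ge0 => // i.
rewrite eseries0 ?adde0// => -[//|k] _ _.
by rewrite /box_volume (bigD1 ord0)//= subrr mul0r.
Qed.

(** * Cutting boxes; Carathéodory measurability of closed sets *)

Definition set_coord x i (c : R) : V := \row_j (if j == i then c else x ord0 j).

Definition box_below B i c := (B.1, set_coord B.2 i c).
Definition box_above B i c := (set_coord B.1 i c, B.2).

Lemma is_box_below B i c : is_box B -> B.1 ord0 i <= c -> is_box (box_below B i c).
Proof. by move=> hB ic j; rewrite /= mxE; case: eqP => [->|]. Qed.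

Lemma is_box_above B i c : is_box B -> c <= B.2 ord0 i -> is_box (box_above B i c).
Proof. by move=> hB ic j; rewrite /= mxE; case: eqP => [->|]. Qed.

Lemma box_volume_cut B i c :
  box_volume B = box_volume (box_below B i c) + box_volume (box_above B i c).
Proof.
have volE C : box_volume C = (C.2 ord0 i - C.1 ord0 i) *
    \prod_(j < d.+1 | j != i) (C.2 ord0 j - C.1 ord0 j).
  by rewrite /box_volume (bigD1 i).
rewrite !volE/= !mxE eqxx.
have -> : \prod_(j < d.+1 | j != i) (set_coord B.2 i c ord0 j - B.1 ord0 j) =
    \prod_(j < d.+1 | j != i) (B.2 ord0 j - B.1 ord0 j).
  by apply: eq_bigr => j /negbTE ji; rewrite mxE ji.
have -> : \prod_(j < d.+1 | j != i) (B.2 ord0 j - set_coord B.1 i c ord0 j) =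
    \prod_(j < d.+1 | j != i) (B.2 ord0 j - B.1 ord0 j).
  by apply: eq_bigr => j /negbTE ji; rewrite mxE ji.
by ring.
Qed.

Lemma box_cut B i c x : box B x ->
  (x ord0 i <= c -> box (box_below B i c) x) /\
  (c <= x ord0 i -> box (box_above B i c) x).
Proof.
move=> Bx; split => xc j /=; have /andP[lj rj] := Bx j.
  by rewrite mxE lj/=; case: eqP => [->|].
by rewrite mxE rj andbT; case: eqP => [->|].
Qed.

(** Cutting every box of a cover of [X] along the hyperplane covers both pieces of [X], and the
    volumes add up box by box. *)
Lemma caratheodory_halfspace i (a : R) :
  caratheodory_measurable mu [set x : V | x ord0 i <= a].
Proof.
apply: le_caratheodory_measurable => X.
apply: le_ereal_inf_tmp => _ [B [hB XB] <-].
(* The level [a] is clamped to the [i]-th side of the box, so that a box on one side of the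
   hyperplane is cut into itself and a degenerate box. *)
pose c k := Num.max ((B k).1 ord0 i) (Num.min a ((B k).2 ord0 i)).
have lc k : (B k).1 ord0 i <= c k by rewrite le_max lexx.
have cr k : c k <= (B k).2 ord0 i by rewrite ge_max hB ge_min lexx orbT.
have hl k : is_box (box_below (B k) i (c k)) by exact: is_box_below.
have hu k : is_box (box_above (B k) i (c k)) by exact: is_box_above.
rewrite (eq_eseriesr (g := fun k => ((box_volume (box_below (B k) i (c k)))%:E +
    (box_volume (box_above (B k) i (c k)))%:E)%E)); last first.
  by move=> k _; rewrite (box_volume_cut _ i (c k)).
rewrite nneseriesD; try by move=> k _ _; exact: box_volume_ge0.
apply: leeD; apply: ereal_inf_lbound; [exists (fun k => box_below (B k) i (c k))|
    exists (fun k => box_above (B k) i (c k))] => //; split => // x.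
- move=> [/XB[k _ Bx] /= xa]; exists k => //; apply: (box_cut i _ Bx).1.
  by rewrite le_max le_min xa; have /andP[_ ->] := Bx i; rewrite orbT.
- move=> [/XB[k _ Bx] /= /negP xa]; exists k => //; apply: (box_cut i _ Bx).2.
  by rewrite ge_max ge_min; have /andP[-> _] := Bx i; rewrite ltW// ltNge.
Qed.

Lemma caratheodory_box B : caratheodory_measurable mu (box B).
Proof.
(* The lower bounds need the open half-spaces [x_i < l], which are countable unions of the closed
   ones [x_i <= l - 1/(k+1)]. *)
have -> : box B = \bigcap_(i in [set: 'I_d.+1]) ([set x | x ord0 i <= B.2 ord0 i] `&`
    ~` (\bigcup_k [set x | x ord0 i <= B.1 ord0 i - k.+1%:R^-1])).
  apply/seteqP; split => x.
    move=> Bx i _; have /andP[li ri] := Bx i; split => //= -[k _ /= xk].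
    by have := le_trans li xk; rewrite lerBrDr gerDl leNgt invr_gt0 ltr0n.
  move=> Bx i; have [/= -> xN] := Bx i Logic.I; rewrite andbT leNgt.
  apply/negP => xl; apply: xN.
  have [k kx] := ltr_add_invr xl; exists k => //=.
  by rewrite lerBrDr ltW.
apply: (@fin_bigcap_measurable _ (caratheodory_type mu)) => // i _.
apply: caratheodory_measurable_setI; first exact: caratheodory_halfspace.
apply: caratheodory_measurable_setC; apply: caratheodory_measurable_bigcup => k.
exact: caratheodory_halfspace.
Qed.

(** The open complement is the union of the countably many boxes with rational corners that it
    contains. *)
Lemma caratheodory_closed S : closed S -> caratheodory_measurable mu S.
Proof.
move=> /closed_openC oS; rewrite -[S]setCK; apply: caratheodory_measurable_setC.
move: (~` S) oS => U oU.
pose Q := ('rV[rat]_d.+1 * 'rV[rat]_d.+1)%type.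
pose QB (q : Q) : V * V := (map_mx ratr q.1, map_mx ratr q.2).
(* The inclusion in [U] is a condition inside the set, so that the union runs over the whole
   countable type [Q]. *)
have -> : U = \bigcup_q [set x | box (QB q) `<=` U /\ box (QB q) x].
  apply/seteqP; split => x; last by move=> [q _ [qU]]; exact: qU.
  move: oU; rewrite openE => /[apply] /nbhs_ballP[e /= e0 xU].
  have [l xl] : {l : 'I_d.+1 -> rat & forall i, ratr (l i) \in `]x ord0 i - e, x ord0 i[%R}.
    by apply: (@choice _ _ (fun i q => ratr q \in `]x ord0 i - e, x ord0 i[%R)) => i;
      apply: rat_in_itvoo; lra.
  have [r xr] : {r : 'I_d.+1 -> rat & forall i, ratr (r i) \in `]x ord0 i, x ord0 i + e[%R}.
    by apply: (@choice _ _ (fun i q => ratr q \in `]x ord0 i, x ord0 i + e[%R)) => i;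
      apply: rat_in_itvoo; lra.
  exists (\row_i l i, \row_i r i) => //=; split => [y By|i].
    apply: xU; split => // i' i; rewrite (ord1 i').
    have := By i; rewrite !mxE; have := xl i; have := xr i; rewrite !in_itv/=.
    move=> /andP[? ?] /andP[? ?] /andP[? ?].
    by rewrite -ball_normE /= ltr_norml; apply/andP; split; lra.
  rewrite !mxE; have := xl i; have := xr i; rewrite !in_itv/=.
  by move=> /andP[? ?] /andP[? ?]; apply/andP; split; lra.
apply: (@countable_bigcupT_measurable _ (caratheodory_type mu)) => [|q].
  exact: (@countableP _ [set: Q]).
have [qU|qU] := pselect (box (QB q) `<=` U).
  rewrite (_ : [set x | _] = box (QB q)); first exact: caratheodory_box.
  by apply/seteqP; split => x // [].
rewrite (_ : [set x | _] = set0); first exact: caratheodory_measurable_set0.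
by apply/seteqP; split => x // [].
Qed.

(** * Homotheties and null sets *)

Definition homothety (a : R) b x : V := a *: x + b.

Lemma le_lebesgue_outer_measure_homothety (a : R) b S : 0 < a ->
  (mu (homothety a b @` S) <= (a ^+ d.+1)%:E * mu S)%E.
Proof.
move=> a0; have aD0 : 0 < a ^+ d.+1 by rewrite exprn_gt0.
rewrite -lee_pdivrMl//; apply: le_ereal_inf_tmp => _ [B [hB SB] <-].
rewrite lee_pdivrMl// -nneseriesZl; last by move=> k _; exact: box_volume_ge0.
apply: ereal_inf_lbound; exists (fun k => (a *: (B k).1 + b, a *: (B k).2 + b)).
  split => [k i|_ [x Sx <-]]; rewrite /=.
    by rewrite !mxE lerD2r ler_pM2l//; exact: hB.
  have [k _ Bx] := SB _ Sx; exists k => // i /=; have /andP[li ri] := Bx i.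
  by rewrite !mxE !lerD2r !ler_pM2l// li ri.
apply: eq_eseriesr => k _; rewrite -EFinM; congr EFin.
rewrite /box_volume -[X in a ^+ X](card_ord d.+1) -prodr_const -big_split/=.
by apply: eq_bigr => i _; rewrite !mxE; ring.
Qed.

(** The missing inequality is the previous one for the inverse homothety. *)
Lemma lebesgue_outer_measure_homothety (a : R) b S : 0 < a ->
  (mu (homothety a b @` S) = (a ^+ d.+1)%:E * mu S)%E.
Proof.
move=> a0; have aD0 : 0 < a ^+ d.+1 by rewrite exprn_gt0.
apply/eqP; rewrite eq_le le_lebesgue_outer_measure_homothety//=.
rewrite -lee_pdivlMl//.
have := le_lebesgue_outer_measure_homothety (- (a^-1 *: b))
  (homothety a b @` S) (a := a^-1).
rewrite invr_gt0 => /(_ a0); rewrite exprVn => h; apply: le_trans h.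
apply: le_lebesgue_outer_measure => x Sx; exists (a *: x + b); first by exists x.
by rewrite /homothety scalerDr scalerA mulVf ?gt_eqF// scale1r addrK.
Qed.

Lemma lebesgue_outer_measure_bounded S (M : R) :
  (forall x, S x -> `|x| <= M) -> (mu S < +oo)%E.
Proof.
move=> SM; have [S0|/set0P[x0 Sx0]] := eqVneq S set0.
  by rewrite S0 lebesgue_outer_measure0.
have M0 : 0 <= M by rewrite (le_trans _ (SM _ Sx0)).
have hB : is_box ((const_mx (- M), const_mx M) : V * V).
  by move=> i; rewrite /= !mxE; lra.
apply: le_lt_trans (ltry _); apply: le_trans (lebesgue_outer_measure_box hB).
apply: le_lebesgue_outer_measure => x /SM /(rV_norm_le _ M0) xM i /=.
by rewrite !mxE -ler_norml.
Qed.

Lemma lebesgue_outer_measure_bigcup0 (I : countType) (F : I -> set V) :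
  (forall i, mu (F i) = 0%E) -> mu (\bigcup_i F i) = 0%E.
Proof.
move=> F0; apply/eqP; rewrite eq_le lebesgue_outer_measure_ge0 andbT.
pose G k := if unpickle k is Some i then F i else set0.
apply: (@le_trans _ _ (mu (\bigcup_k G k))).
  apply: le_lebesgue_outer_measure => x [i _ Fx]; exists (pickle i) => //.
  by rewrite /G pickleK.
apply: le_trans (lebesgue_outer_measure_sigma_subadditive _) _.
rewrite eseries0// => k _ _; rewrite /G; case: unpickle => [i|]; first exact: F0.
exact: lebesgue_outer_measure0.
Qed.

(** A set of outer measure zero is Carathéodory measurable, so [S] itself witnesses
    negligibility. *)
Lemma ae_lebesgue_outer_measure (P : V -> Prop) S :
  mu S = 0%E -> (forall x, ~ S x -> P x) -> {ae lebesgue_measure_rV R d, forall x, P x}.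
Proof.
move=> S0 SP; exists S; split => //; last first.
  by move=> x /= nP; apply: contrapT => /SP.
apply: le_caratheodory_measurable => X.
rewrite -[leRHS]add0e; apply: leeD.
  by rewrite -S0; apply: le_lebesgue_outer_measure => x [].
by apply: le_lebesgue_outer_measure => x [].
Qed.

End lebesgue_outer_measure_theory.

(** * Porous sets are null *)

Section porous_sets.
Set Implicit Arguments.
Unset Strict Implicit.
Context (R : realType) (d : nat).
Notation V := 'rV[R]_d.+1.
Notation mu := (@lebesgue_outer_measure R d).
Implicit Types (B : V * V) (A K : set V).

Lemma homothety_continuous (a : R) (b : V) : continuous (homothety a b).
Proof.
move=> x.
have h := @cvgD R V V (nbhs x) _ (fun y => a *: y) (fun=> b) (a *: x) b.
exact: (h _ (@scaler_continuous R V a x) (cvg_cst b)).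
Qed.

Definition side B i : R := B.2 ord0 i - B.1 ord0 i.

(* Slabs of width [s] are cut off a box until all its sides lie in [s, 2s]. *)
Lemma box_bound_subdivision A (c s : R) : 0 < s ->
  (forall B, (forall i, s <= side B i <= 2 * s) ->
    (mu (A `&` box B) <= (c * box_volume B)%:E)%E) ->
  forall (N : nat) B, (forall i, s <= side B i) -> \sum_i side B i <= s * N%:R ->
    (mu (A `&` box B) <= (c * box_volume B)%:E)%E.
Proof.
move=> s0 hA; elim=> [|N IH] B sB sumB.
  exfalso; have : s <= \sum_i side B i.
    rewrite (bigD1 ord0)//= (le_trans (sB ord0))// lerDl sumr_ge0// => i _.
    by rewrite (le_trans (ltW s0)).
  by lra.
have [/forallP sB2|/forallPn[i]] := boolP [forall i, side B i <= 2 * s].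
  by apply: hA => i; rewrite sB sB2.
rewrite -ltNge => sBi.
(* The [i]-th side exceeds [2 * s]: the lower piece keeps side [s], the upper one more than [s].
   Both sums of sides drop by at least [s], which drives the induction on [N]. *)
pose e := B.1 ord0 i + s.
have sideD C : \sum_j side C j = side C i + \sum_(j | j != i) side C j.
  by rewrite (bigD1 i).
have belowE j : side (box_below B i e) j = if j == i then s else side B j.
  by rewrite /side /= mxE; case: eqP => [->|//]; rewrite /e addrC addKr.
have aboveE j : side (box_above B i e) j = if j == i then side B i - s else side B j.
  by rewrite /side /= mxE; case: eqP => [->|//]; rewrite /e opprD addrA.
have : \sum_j side B j <= s * N.+1%:R := sumB.
rewrite sideD -natr1 => sumB'.
rewrite (box_volume_cut _ i e) mulrDr EFinD.
apply: (@le_trans _ _ (mu (A `&` box (box_below B i e)) +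
                       mu (A `&` box (box_above B i e)))%E).
  apply: le_trans (outer_measureU2 _ _ _); apply: le_lebesgue_outer_measure.
  move=> x [Ax Bx]; have [le_e|/ltW ge_e] := leP (x ord0 i) e.
    by left; split => //; exact: (box_cut i _ Bx).1.
  by right; split => //; exact: (box_cut i _ Bx).2.
apply: leeD; apply: IH.
- by move=> j; rewrite belowE; case: ifP.
- rewrite sideD belowE eqxx (eq_bigr (side B)); first by lra.
  by move=> j /negbTE ji; rewrite belowE ji.
- by move=> j; rewrite aboveE; case: ifP => // _; lra.
- rewrite sideD aboveE eqxx (eq_bigr (side B)); first by lra.
  by move=> j /negbTE ji; rewrite aboveE ji.
Qed.

Lemma outer_measure_box_bound_eq0 A (c : R) : (mu A < +oo)%E -> 0 < c < 1 ->
  (forall B, is_box B -> (mu (A `&` box B) <= (c * box_volume B)%:E)%E) ->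
  mu A = 0%E.
Proof.
move=> Aoo /andP[c0 c1] hA.
(* With [c^-1] on the left, it suffices to bound the total volume of each cover of [A] from
   below. *)
have : (c^-1%:E * mu A <= mu A)%E.
  apply: le_ereal_inf_tmp => _ [B [hB AB] <-].
  rewrite lee_pdivrMl// -nneseriesZl; last by move=> k _; exact: box_volume_ge0.
  apply: (@le_trans _ _ (mu (\bigcup_k (A `&` box (B k))))).
    apply: le_lebesgue_outer_measure => x Ax; have [k _ Bx] := AB _ Ax.
    by exists k.
  apply: le_trans (lebesgue_outer_measure_sigma_subadditive _) _.
  apply: lee_nneseries => [k _ _|k _]; first exact: lebesgue_outer_measure_ge0.
  by rewrite -EFinM; exact: hA.
have := lebesgue_outer_measure_ge0 A.
rewrite lee_pdivrMl//; move: Aoo; case: (mu A) => [r| |]//= _.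
rewrite -EFinM !lee_fin => r0 rc; congr EFin; apply/eqP; rewrite eq_le r0 andbT.
by nra.
Qed.

(** A box with sides in [[s, 2s]] has volume at most [(2s)^(d+1)] and contains a copy of [K] of
    measure at least [(eta s)^(d+1) mu K] off [A]. So [A] misses a fixed proportion of it, and
    subdivision carries this over to all boxes. *)
Lemma outer_measure_porous_eq0 A K (eta s0 : R) :
  (mu A < +oo)%E -> compact K -> (0 < mu K)%E -> 0 < eta -> 0 < s0 ->
  (forall B s, 0 < s <= s0 -> (forall i, s <= side B i <= 2 * s) ->
    exists a b, [/\ eta * s <= a, homothety a b @` K `<=` box B &
                    homothety a b @` K `<=` ~` A]) ->
  mu A = 0%E.
Proof.
move=> Aoo cK K0 eta0 s00 porous.
have [M [_ KM]] := compact_bounded cK.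
have Koo : (mu K < +oo)%E.
  by apply: (@lebesgue_outer_measure_bounded _ _ _ (M + 1)) => x /KM; apply; rewrite ltrDl.
have [m m0 mE] : exists2 m : R, 0 < m & mu K = m%:E.
  by move: K0 Koo; case: (mu K) => [r| |]//= r0 _; exists r.
(* [c0] is the quotient of [(eta s)^(d+1) m] by [(2s)^(d+1)]; the cap [1 / 2] in [c] keeps [1 - c]
   strictly between 0 and 1. *)
pose c0 := (eta / 2) ^+ d.+1 * m.
pose c := Num.min c0 (1 / 2).
have c00 : 0 < c0 by rewrite mulr_gt0// exprn_gt0// divr_gt0.
have c_gt0 : 0 < c by rewrite lt_min c00 divr_gt0.
have c_le : c <= 1 / 2 by rewrite ge_min lexx orbT.
apply: (@outer_measure_box_bound_eq0 _ (1 - c)) => //.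
  by apply/andP; split; lra.
(* This [s] is at most [s0] and at most every side of [B], so both porosity and subdivision apply
   once all sides are positive. *)
move=> B hB; pose s := \big[Num.min/s0]_i side B i.
have [/forallP sB0|/forallPn[i]] := boolP [forall i, 0 < side B i]; last first.
  rewrite -leNgt => Bi0; have -> : box_volume B = 0.
    rewrite /box_volume (bigD1 i)//=; apply/eqP; rewrite mulf_eq0; apply/orP; left.
    by rewrite eq_le Bi0 subr_ge0 hB.
  rewrite mulr0; apply: (@le_trans _ _ (mu (box B))).
    by apply: le_lebesgue_outer_measure => x [].
  apply: le_trans (lebesgue_outer_measure_box hB) _.
  rewrite lee_fin /box_volume (bigD1 i)//= mulr_le0_ge0//.
  by rewrite prodr_ge0// => j _; rewrite subr_ge0.
have s_gt0 : 0 < s by apply: lt_bigmin.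
apply: (@box_bound_subdivision _ _ s s_gt0 _
  (Num.bound ((\sum_i side B i) / s))); last 2 first.
- by move=> i; exact: bigmin_le.
- rewrite mulrC -ler_pdivrMr// ltW// archi_boundP// divr_ge0 ?(ltW s_gt0)//.
  by rewrite sumr_ge0// => i _; exact: ltW.
move=> C hC.
have s_le : 0 < s <= s0 by rewrite s_gt0 bigmin_le_id.
have [a [b [etaa KB KA]]] := porous C s s_le hC.
have a0 : 0 < a by apply: lt_le_trans etaa; rewrite mulr_gt0.
have bC : is_box C.
  by move=> i; rewrite -subr_ge0; have /andP[+ _] := hC i; exact/le_trans/ltW.
(* Being closed, the copy of [K] is measurable and splits the outer measure of the box
   additively. *)
have cK' : closed (homothety a b @` K).
  apply: compact_closed; first exact: norm_hausdorff.
  apply: continuous_compact => //; apply: continuous_subspaceT => x.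
  exact: homothety_continuous.
have mB : (mu (homothety a b @` K) + mu (A `&` box C) <= (box_volume C)%:E)%E.
  apply: le_trans (lebesgue_outer_measure_box bC).
  rewrite [leRHS](caratheodory_closed cK'); apply: leeD.
    by apply: le_lebesgue_outer_measure => x Kx; split => //; exact: KB.
  by apply: le_lebesgue_outer_measure => x [Ax Bx]; split => // /KA.
have vB : c * box_volume C <= a ^+ d.+1 * m.
  apply: (@le_trans _ _ (c0 * (2 * s) ^+ d.+1)).
    apply: ler_pM; [exact: ltW| |by rewrite ge_min lexx|].
      by rewrite prodr_ge0// => i _; rewrite subr_ge0.
    rewrite -[X in _ <= _ ^+ X](card_ord d.+1) -prodr_const; apply: ler_prod => i _.
    by have /andP[s1 ->] := hC i; rewrite andbT subr_ge0.
  rewrite /c0 mulrAC -exprMn ler_pM2r//.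
  rewrite (_ : eta / 2 * (2 * s) = eta * s); last by field.
  by apply: lerXn2r => //; rewrite nnegrE ltW// mulr_gt0.
move: mB; rewrite lebesgue_outer_measure_homothety// mE.
have := lebesgue_outer_measure_ge0 (A `&` box C).
case: (mu (A `&` box C)) => [r| |]//= r0.
by rewrite -EFinM -EFinD !lee_fin; lra.
Qed.

End porous_sets.

(** * Words, contraction ratios and cylinders of the attractor *)

Section universal_codings.
Set Implicit Arguments.
Unset Strict Implicit.
Context (R : realType) (d n : nat).
Notation V := 'rV[R]_d.+1.
Notation mu := (@lebesgue_outer_measure R d).
Context (lambda : 'I_n -> R) (p : 'I_n -> V) (Lambda : set V).
Notation f := (contraction_map lambda p).
Context (lambda01 : forall j, 0 < lambda j < 1)
  (attractor_Lambda : is_attractor f Lambda).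
Implicit Types (u v w : seq 'I_n) (x y : V).

Definition word_ratio w : R := \prod_(j <- w) lambda j.

Lemma word_ratio_gt0 w : 0 < word_ratio w.
Proof. by apply: prodr_gt0 => j _; have /andP[] := lambda01 j. Qed.

Lemma word_map_cat u v x : word_map f (u ++ v) x = word_map f u (word_map f v x).
Proof. by elim: u => //= j u ->. Qed.

Lemma word_map_homothety w : word_map f w = homothety (word_ratio w) (word_map f w 0).
Proof.
apply/funext => x; rewrite /homothety /word_ratio.
elim: w => [|j w IH]; first by rewrite big_nil scale1r addr0.
by rewrite big_cons /= /contraction_map IH scalerDr scalerA addrA.
Qed.

Lemma word_map_attractor w x : Lambda x -> Lambda (word_map f w x).
Proof.
case: attractor_Lambda => _ _ eL Lx; elim: w => //= j w Lw.
by rewrite eL; exists j => //; exists (word_map f w x).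
Qed.

Lemma attractor_bounded : exists2 M : R, 0 < M & forall x, Lambda x -> `|x| <= M.
Proof.
case: attractor_Lambda => _ /compact_bounded[M [_ LM]] _.
exists (`|M| + 1) => [|x]; first by rewrite ltr_wpDl.
by apply: LM; rewrite (le_lt_trans (ler_norm _))// ltrDl.
Qed.

Lemma ratio_bounds : exists r s : R,
  [/\ 0 < r, s < 1, 0 < s & forall j, r <= lambda j <= s].
Proof.
(* The default value [1 / 2] of the maximum keeps [s] positive and below 1. *)
exists (\big[Num.min/1]_j lambda j), (\big[Num.max/(1 / 2)]_j lambda j); split.
- by apply: lt_bigmin => // j _; case/andP: (lambda01 j).
- by apply: bigmax_lt => [|j _]; [lra|case/andP: (lambda01 j)].
- by apply: (@lt_le_trans _ _ (1 / 2)); [lra|exact: bigmax_ge_id].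
- by move=> j; rewrite bigmin_le le_bigmax.
Qed.

(* [r] bounds all the contraction ratios from below, so the ratio of a cylinder
   around [x] can be prescribed up to the factor [r]. *)
Lemma attractor_cylinder (r s : R) : 0 < r -> 0 < s < 1 ->
  (forall j, r <= lambda j <= s) -> forall x (t : R), Lambda x -> 0 < t <= 1 ->
  exists u y, [/\ Lambda y, x = word_map f u y & r * t <= word_ratio u <= t].
Proof.
move=> r0 /andP[s0 s1] rs x t Lx /andP[t0 t1].
(* [N] bounds the length of [u]: passing to a first-level cylinder replaces [t] by [t / lambda j],
   which is at least [s ^+ N] when [t] is at least [s ^+ N.+1]. *)
have [N sN] : exists N, s ^+ N <= t.
  have /cvgrPdist_lt /(_ t t0)[N _ /(_ N (leqnn N))] : s ^+ k @[k --> \oo] --> (0 : R).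
    by apply: cvg_expr; rewrite ger0_norm// ltW.
  rewrite sub0r normrN ger0_norm ?exprn_ge0 ?(ltW s0)// => /ltW; by exists N.
have eL : Lambda = \bigcup_(j in [set: 'I_n]) (f j @` Lambda).
  by case: attractor_Lambda.
elim: N x t Lx t0 t1 sN => [|N IH] x t Lx t0 t1 sN.
  exists [::], x; split => //; rewrite /word_ratio big_nil.
  have -> : t = 1 by apply/eqP; rewrite eq_le t1 sN.
  have [y [j _ _]] : (\bigcup_(j in [set: 'I_n]) (f j @` Lambda)) !=set0.
    by rewrite -eL; exists x.
  by case/andP: (rs j) => rj _; case/andP: (lambda01 j) => _ l1; lra.
move: Lx; rewrite {1}eL => -[j _ [y Ly <-]].
have /andP[rj js] := rs j; have /andP[l0 l1] := lambda01 j.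
(* Stop at the first letter that brings the ratio down to [t] or less; as [lambda j] is at least
   [r], the ratio does not fall below [r * t]. *)
have [lt|tl] := leP (lambda j) t.
  exists [:: j], y; split => //; rewrite /word_ratio big_seq1 lt andbT.
  by rewrite (le_trans _ rj)// ger_pMr.
have [||| u [z [Lz yz /andP[ru ut]]]] := IH y (t / lambda j) Ly.
- by rewrite divr_gt0.
- by rewrite ler_pdivrMr// mul1r ltW.
- rewrite ler_pdivlMr// (le_trans _ sN)// exprSr ler_wpM2l// exprn_ge0// ltW//.
exists (j :: u), z; split => //; first by rewrite /= -yz.
move: ru ut; rewrite /word_ratio big_cons mulrA ler_pdivrMr// ler_pdivlMr//.
by rewrite [lambda j * _]mulrC => -> ->.
Qed.

(** * Points avoiding a word and the exceptional null set *)

Definition avoiding w : set V :=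
  Lambda `\` \bigcup_u (word_map f (u ++ w) @` Lambda).

Lemma avoiding_eq0 w : (0 < mu Lambda)%E -> mu (avoiding w) = 0%E.
Proof.
move=> L0; have [M M0 LM] := attractor_bounded.
have [r [s [r0 s1 s0 rs]]] := ratio_bounds.
have [_ cL _] := attractor_Lambda.
have ww0 := word_ratio_gt0 w.
have ww1 : word_ratio w <= 1.
  by apply: prodr_ile1 => j _; case/andP: (lambda01 j) => /ltW -> /ltW ->.
have r1 : r < 1.
  have [[x Lx] _ eL] := attractor_Lambda.
  move: Lx; rewrite eL => -[j _ _].
  by case/andP: (rs j) => + _; case/andP: (lambda01 j) => _; lra.
(* With [t = h / (8 * M)], the cylinder found below has ratio at least [r * t * word_ratio w], which
   is [eta * h]. The bound [8 * M] on [h] ensures [t <= 1]. *)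
pose eta := r * word_ratio w / (8 * M).
have eta0 : 0 < eta by rewrite divr_gt0 ?mulr_gt0.
apply: (@outer_measure_porous_eq0 _ _ _ Lambda eta (8 * M)) => //; last 2 first.
- by rewrite mulr_gt0.
- move=> B h /andP[h0 h8] hB.
  pose z : V := \row_i ((B.1 ord0 i + B.2 ord0 i) / 2).
  have near_z x : `|x - z| <= h / 2 -> box B x.
    have h20 : 0 <= h / 2 by rewrite ltW// divr_gt0.
    move=> /(rV_norm_le _ h20) xz i; have := xz i; have := hB i.
    rewrite /side ler_norml !mxE => /andP[? ?] /andP[? ?].
    by apply/andP; split; lra.
  pose t := h / (8 * M).
  have t01 : 0 < t <= 1.
    by rewrite /t divr_gt0 ?mulr_gt0//= ler_pdivrMr ?mulr_gt0// mul1r.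
  have [t0 t1] := andP t01.
  have t20 : 0 < 2 * t by rewrite pmulr_rgt0.
  have tM : t * M = h / 8 by rewrite /t; field; rewrite gt_eqF.
  have etah : eta * h = r * word_ratio w * t by rewrite /eta /t; ring.
  (* The copy of [Lambda] of ratio [2 * t] at the centre [z] stays within [h / 4] of [z]. If it
     misses [avoiding w], it is the required hole; otherwise it contains a point [x] of [Lambda],
     and a cylinder around [x] of diameter at most [h / 4] stays within [h / 2] of [z]. *)
  have [hA|/existsNP[x /not_implyP[[y Ly xy] nA]]] :=
      pselect (forall x, (homothety (2 * t) z @` Lambda) x -> ~ avoiding w x).
    exists (2 * t), z; split => //.
      rewrite etah; have : r * word_ratio w <= 1.
        by rewrite mulr_ile1// ltW.
      by nra.
    move=> _ [y Ly <-]; apply: near_z; rewrite /homothety addrK normrZ.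
    have := LM _ Ly; rewrite gtr0_norm// => yM.
    by rewrite (le_trans (ler_wpM2l (ltW t20) yM))//; lra.
  move/contrapT: nA => -[Lx _].
  have s01 : 0 < s < 1 by rewrite s0.
  have [u [y' [Ly' xE /andP[ru ut]]]] := attractor_cylinder r0 s01 rs Lx t01.
  exists (word_ratio (u ++ w)), (word_map f (u ++ w) 0).
  rewrite -word_map_homothety; split.
  + rewrite etah /word_ratio big_cat/= mulrAC ler_pM2r//.
  + move=> _ [y'' Ly'' <-]; apply: near_z; rewrite word_map_cat.
    set v := word_map f w y''; have Lv : Lambda v by exact: word_map_attractor.
    have xz : `|x - z| <= h / 4.
      rewrite -xy /homothety addrK normrZ gtr0_norm//.
      have := LM _ Ly => yM.
      by rewrite (le_trans (ler_wpM2l (ltW t20) yM))//; lra.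
    have vx : `|word_map f u v - x| <= h / 4.
      rewrite xE word_map_homothety /homothety opprD addrACA subrr addr0.
      rewrite -scalerBr normrZ gtr0_norm ?word_ratio_gt0//.
      have yM : `|v - y'| <= 2 * M.
        by rewrite (le_trans (ler_normB _ _))//; have := LM _ Lv; have := LM _ Ly'; lra.
      rewrite (le_trans (ler_pM _ _ ut yM))//; first exact/ltW/word_ratio_gt0.
      by rewrite mulrCA tM; lra.
    rewrite -(subrK x (word_map f u v)) -addrA (le_trans (ler_normD _ _))//.
    by lra.
  + by move=> _ [y'' Ly'' <-] [_]; apply; exists u => //; exists y''.
- apply: (@lebesgue_outer_measure_bounded _ _ _ M) => x [Lx _]; exact: LM.
Qed.

(** Taking images under all words makes the complement stable under passing to tails: if
    [word_map f v y] is not exceptional, neither is [y]. *)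
Definition exceptional : set V :=
  \bigcup_v (word_map f v @` \bigcup_w avoiding w).

Lemma exceptional_eq0 : (0 < mu Lambda)%E -> mu exceptional = 0%E.
Proof.
move=> L0; apply: lebesgue_outer_measure_bigcup0 => v.
rewrite word_map_homothety lebesgue_outer_measure_homothety ?word_ratio_gt0//.
by rewrite lebesgue_outer_measure_bigcup0 ?mule0// => w; exact: avoiding_eq0.
Qed.

(** The tail [y] is again a non-exceptional point of [Lambda], so the step can be repeated with
    another word. *)
Lemma not_exceptional_step w x : Lambda x -> ~ exceptional x ->
  exists u y, [/\ Lambda y, ~ exceptional y & x = word_map f (u ++ w) y].
Proof.
move=> Lx nx; have : ~ avoiding w x.
  by move=> xw; apply: nx; exists [::] => //; exists x => //; exists w.
move=> /not_andP[//|/contrapT[u _ [y Ly yx]]].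
exists u, y; split => // -[v _ [a aw ay]]; apply: nx.
by exists ((u ++ w) ++ v) => //; exists a => //; rewrite word_map_cat ay.
Qed.

(** * Construction of universal codings *)

Lemma word_ratio_le (s : R) w : (forall j, lambda j <= s) ->
  word_ratio w <= s ^+ size w.
Proof.
move=> ls; rewrite /word_ratio; elim: w => [|j w IH]; first by rewrite big_nil.
rewrite big_cons exprS ler_pM//; last exact: ltW (word_ratio_gt0 w).
by case/andP: (lambda01 j) => /ltW.
Qed.

(** The points [x] and [word_map f (mkseq eps N) 0] differ by the ratio of the word times [y], of
    norm at most [s ^+ N * M]. *)
Lemma is_coding_cylinders x (eps : nat -> 'I_n) :
  (forall N, exists2 y, Lambda y & x = word_map f (mkseq eps N) y) ->
  is_coding f x eps.
Proof.
move=> xeps; have [M M0 LM] := attractor_bounded.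
have [r [s [_ s1 s0 rs]]] := ratio_bounds.
apply/cvgrPdist_lt => e e0.
have /cvgrPdist_lt /(_ (e / M)) : s ^+ k @[k --> \oo] --> (0 : R).
  by apply: cvg_expr; rewrite ger0_norm// ltW.
rewrite divr_gt0// => /(_ isT); apply: filterS => N.
rewrite sub0r normrN ger0_norm ?exprn_ge0 ?(ltW s0)// ltr_pdivlMr//.
apply: le_lt_trans; have [y Ly ->] := xeps N.
rewrite {1}word_map_homothety /homothety addrK normrZ gtr0_norm ?word_ratio_gt0//.
rewrite ler_pM ?(ltW (word_ratio_gt0 _))// ?LM// -[X in s ^+ X](size_mkseq eps).
by apply: word_ratio_le => j; case/andP: (rs j).
Qed.

Lemma has_universal_coding_not_exceptional x :
  Lambda x -> ~ exceptional x -> has_universal_coding f x.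
Proof.
move=> Lx nx.
have [j0] : exists j : 'I_n, True.
  by move: Lx; case: attractor_Lambda => _ _ -> [j _ _]; exists j.
(* All words are enumerated, with the empty word at numbers that encode none; the extra letter [j0]
   makes every appended block nonempty. *)
move=> _; pose word k : seq 'I_n := j0 :: odflt [::] (unpickle k).
pose P W := exists y, [/\ Lambda y, ~ exceptional y & x = word_map f W y].
have [g gP] : {g : nat * seq 'I_n -> seq 'I_n &
    forall kW, P kW.2 -> P (kW.2 ++ g kW ++ word kW.1)}.
  apply: (@choice _ _ (fun kW u => P kW.2 -> P (kW.2 ++ u ++ word kW.1))) => -[k W] /=.
  have [[y [Ly ny xy]]|nP] := pselect (P W); last by exists [::].
  have [u [z [Lz nz yz]]] := not_exceptional_step (word k) Ly ny.
  by exists u => _; exists z; split => //; rewrite word_map_cat -yz.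
(* Nested prefixes of the coding: stage [k] appends a filler chosen by [g] and then [word k], with
   [x] always in the cylinder of the prefix. *)
pose Ws := fix Ws k := if k is k'.+1 then Ws k' ++ g (k', Ws k') ++ word k' else [::].
have PW k : P (Ws k).
  by elim: k => [|k IH]; [exists x | exact: (gP (k, Ws k))].
have sizeW k : (k <= size (Ws k))%N.
  by elim: k => //= k IH; rewrite !size_cat/= !addnS ltnS (leq_trans IH)// leq_addr.
have nthW k m i : (i < size (Ws k))%N -> nth j0 (Ws (k + m)%N) i = nth j0 (Ws k) i.
  move=> ik; elim: m => [|m IH]; first by rewrite addn0.
  suff im : (i < size (Ws (k + m)))%N by rewrite addnS /= nth_cat im.
  elim: m {IH} => [|m IH]; first by rewrite addn0.
  by rewrite addnS /= size_cat (leq_trans IH)// leq_addr.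
(* Stage [i.+1] has more than [i] letters, and later stages do not change them. *)
pose eps i := nth j0 (Ws i.+1) i.
have epsW k i : (i < size (Ws k))%N -> eps i = nth j0 (Ws k) i.
  move=> ik; have [ki|/ltnW ki] := leqP k i.+1.
    by rewrite /eps -(subnKC ki) nthW.
  by rewrite -(subnKC ki) nthW ?sizeW.
exists eps; split.
  apply: is_coding_cylinders => N; have [y [Ly _ xy]] := PW N.
  (* [Ws N] may be longer than [N]; its surplus letters are absorbed into the point of [Lambda]. *)
  exists (word_map f (drop N (Ws N)) y); first exact: word_map_attractor.
  rewrite -word_map_cat (_ : mkseq eps N = take N (Ws N)) ?cat_take_drop//.
  apply: (@eq_from_nth _ j0) => [|i]; first by rewrite size_mkseq size_takel.
  rewrite size_mkseq => iN; rewrite nth_mkseq// nth_take//.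
  by apply: epsW; rewrite (leq_trans iN).
move=> N delta; pose k := pickle (tval delta).
have wk : word k = j0 :: delta by rewrite /word pickleK.
(* The block [delta] comes after the prefix, the filler and the letter [j0], whence the [+ 1]. *)
exists (size (Ws k ++ g (k, Ws k)) + 1)%N => i.
rewrite (@epsW k.+1) /= wk catA.
  rewrite nth_cat -addnA ltnNge leq_addr/= addKn add1n/=.
  by rewrite (tnth_nth j0).
by rewrite [X in (_ < X)%N]size_cat/= size_tuple -addnA ltn_add2l add1n ltnS.
Qed.

End universal_codings.

Theorem theorem1p4 (R : realType) (d n : nat) (lambda : 'I_n -> R)
    (p : 'I_n -> 'rV[R]_d.+1) (Lambda : set 'rV[R]_d.+1)
    (lambda01 : forall j : 'I_n, 0 < lambda j < 1)
    (attractor_Lambda : is_attractor (contraction_map lambda p) Lambda)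
    (Lambda_gt0 : (0 < lebesgue_measure_rV R d Lambda)%E) :
  {ae lebesgue_measure_rV R d, forall x,
    Lambda x -> has_universal_coding (contraction_map lambda p) x}.
Proof.
apply: (ae_lebesgue_outer_measure (exceptional_eq0 lambda01 attractor_Lambda Lambda_gt0)).
by move=> x nx Lx; exact: has_universal_coding_not_exceptional Lx nx.
Qed.
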